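(* Let $n$ and $m$ be integers with $n\geq 4$ and $2n<m\leq 3n$. If $m$ is a prime or a double of a prime (that is, $m=2p$ for some prime $p$), then $$\psi_n(m)=\sqrt{m+2\sqrt{2\lfloor m/3\rfloor}};$$ otherwise $\psi_n(m)=\sqrt{m}$.
   Context: The trace norm $\|A\|_*$ of a matrix $A$ is the sum of its singular values. For integers $n\geq 2$ and $1\leq m\leq n^2$, $\mathbb{Z}_n(m)$ denotes the set of $(0,1)$-matrices of size $n\times n$ with exactly $m$ entries equal to $1$, and $\psi_n(m)=\min\{\|A\|_* : A\in\mathbb{Z}_n(m)\}$. *)

(* Defs.v *)
From mathcomp Require Export all_boot all_order all_algebra.
From mathcomp Require Export polyrcf.

Set Implicit Arguments.
Unset Strict Implicit.
Unset Printing Implicit Defensive.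

Import Order.TTheory GRing.Theory Num.Theory.
Local Open Scope ring_scope.

(* A^T *m A is symmetric positive semidefinite, so over a real closed field its
   characteristic polynomial splits and each eigenvalue x is listed here as
   often as its multiplicity.  For m < n the list has n - m additional zeros,
   which do not affect the trace norm. *)
Definition singular_values (R : rcfType) (m n : nat) (A : 'M[R]_(m, n)) : seq R :=
  let p := char_poly (A^T *m A) in
  flatten [seq nseq (mup x p) (Num.sqrt x) | x <- rootsR p].

Definition trace_norm (R : rcfType) (m n : nat) (A : 'M[R]_(m, n)) : R :=
  \sum_(s <- singular_values A) s.

(* (0,1)-matrices are represented as boolean matrices, which form a finite
   type; [mx01] gives the corresponding matrix over [R]. *)
Definition mx01 (R : rcfType) (m n : nat) (A : 'M[bool]_(m, n)) : 'M[R]_(m, n) :=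
  map_mx (fun b : bool => (b : nat)%:R) A.

Definition Zmx (n m : nat) : {set 'M[bool]_n} :=
  [set A : 'M[bool]_n | #|[set ij : 'I_n * 'I_n | A ij.1 ij.2]| == m].

(* The minimum of the trace norm over [Zmx n m].  The value 0 is only used
   when [Zmx n m] is empty, i.e. when n ^ 2 < m. *)
Definition psi (R : rcfType) (n m : nat) : R :=
  if [pick A0 in Zmx n m] is Some A0 then
    trace_norm (mx01 R [arg min_(A < A0 in Zmx n m) trace_norm (mx01 R A)]%O)
  else 0.

(* Main.v *)
Require Import Defs.
From mathcomp Require Import complex zify.

Set Implicit Arguments.
Unset Strict Implicit.
Unset Printing Implicit Defensive.

Import Order.TTheory GRing.Theory Num.Theory.
Local Open Scope ring_scope.

(** Let s_1, ..., s_n be the singular values of A, M := A^T A, and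
    W := (tr M)^2 - tr (M^2).  The squares of the s_i are the eigenvalues of M,
    so W is the sum of s_i^2 s_j^2 over ordered pairs i != j, and
      (s_1 + ... + s_n)^2 = tr M + P,  with P the sum of s_i s_j over i != j.
    Since P^2 >= 2 W, with equality if at most two of the s_i are nonzero,
      trace_norm A >= sqrt (tr M + sqrt (2 W)),
    with equality if A has rank at most 2 ([trace_norm_ge],
    [trace_norm_rank2]).  For a (0,1)-matrix, tr M is the number m of ones, and
    W is the sum over ordered pairs of columns, seen as sets X and Y of rows, of
    #|X| #|Y| - #|X :&: Y|^2.  The problem becomes: make W small.

    If m = a * b with a, b <= n, an a x b block of ones has W = 0, which gives
    the value sqrt m.  For n >= 4 and 2 n < m <= 3 n, such a and b exist
    exactly if m is neither a prime nor twice a prime ([rectangle_exists] and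
    [no_rectangle_prime_factor]).

    If there are no such a and b, then W >= 4 * (m %/ 3)
    ([sum_set_defect_lower]).  Two distinct nonempty columns contribute at least
    the size of the larger one minus 1.  Let r be the largest column size and
    p the number of nonempty columns; p and r are at least 3 because m > 2 n.
    Suppose that t columns equal a fixed largest column and s others are
    nonempty.  As m is not p * r, neither s = 0 nor a full p x r count can
    occur, hence
      W >= 2 * (t * s) * (r - 1) >= 2 * (p - 1) * (r - 1)  and  m <= p * r - 1.
    This yields the bound, except for p = r = 4 and m = 15, where m = 3 * 5.
    The bound is attained by the rank-2 matrix whose columns are m %/ 3 full
    columns of height 3 followed by one column of height m %% 3
    ([trace_norm_euclid_mx]). *)

(** * Trace norm and the spectrum of A^T A *)

Lemma char_poly_conj (F : fieldType) n (P A : 'M[F]_n) :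
  P \in unitmx -> char_poly (invmx P *m A *m P) = char_poly A.
Proof.
move=> Pu; rewrite /char_poly /char_poly_mx.
have PV : map_mx polyC (invmx P) *m map_mx polyC P = 1%:M.
  by rewrite -map_mxM mulVmx // map_mx1.
have -> : 'X%:M - map_mx polyC (invmx P *m A *m P) =
    map_mx polyC (invmx P) *m ('X%:M - map_mx polyC A) *m map_mx polyC P.
  rewrite mulmxBr mulmxBl !map_mxM scalar_mxC.
  by rewrite -[X in _ = X - _]mulmxA PV mulmx1.
by rewrite !det_mulmx mulrC mulrA -det_mulmx (mulmx1C PV) det1 mul1r.
Qed.

Lemma char_poly_diag (F : comNzRingType) n (d : 'rV[F]_n) :
  char_poly (diag_mx d) = \prod_i ('X - (d 0 i)%:P).
Proof.
rewrite char_poly_trig; last exact/is_diag_mx_is_trig/diag_mx_is_diag.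
by apply: eq_bigr => i _; rewrite mxE eqxx mulr1n.
Qed.

Lemma rank_diag_mx_ge (F : fieldType) n (d : 'rV[F]_n) :
  (#|[set i | d 0%R i != 0%R]| <= \rank (diag_mx d))%N.
Proof.
set S := [set i | _].
(* B selects the coordinates in S, where the compressed diagonal matrix is
   invertible. *)
pose B : 'M[F]_(#|S|, n) := rowsub enum_val 1%:M.
have BdB : B *m diag_mx d *m B^T = diag_mx (\row_i d 0 (enum_val i)).
  apply/matrixP=> i j; rewrite !mxE (bigD1 (enum_val j)) //= big1 ?addr0.
    rewrite !mxE eqxx mulr1 (bigD1 (enum_val i)) //= big1 ?addr0.
      by rewrite !mxE eqxx mul1r (inj_eq enum_val_inj).
    by move=> k /negbTE ki; rewrite !mxE eq_sym ki mul0r.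
  by move=> k /negbTE kj; rewrite [B^T k j]mxE !mxE eq_sym kj mulr0.
have -> : #|S| = \rank (B *m diag_mx d *m B^T).
  rewrite BdB mxrank_unit // unitmxE det_diag unitfE.
  by apply/prodf_neq0 => i _; rewrite mxE; have := enum_valP i; rewrite inE.
exact: leq_trans (mxrankM_maxl _ _) (mxrankM_maxr _ _).
Qed.

(** The definition of the trace norm groups the eigenvalues by multiplicity;
    this recovers the sum over an indexed family of eigenvalues. *)
Lemma trace_norm_prodXsubC (R : rcfType) (m n : nat) (A : 'M[R]_(m, n))
    (lam : 'I_n -> R) :
  char_poly (A^T *m A) = \prod_i ('X - (lam i)%:P) ->
  trace_norm A = \sum_i Num.sqrt (lam i).
Proof.
move=> pE; rewrite /trace_norm /singular_values.
set p := char_poly _ in pE *.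
have p0 : p != 0 by rewrite monic_neq0 // char_poly_monic.
set L := codom lam.
have pL : p = \prod_(y <- L) ('X - y%:P).
  by rewrite pE /L codomE big_map big_enum.
rewrite big_flatten /= big_map.
under eq_bigr => x _ do rewrite big_nseq iter_addr_0 pL mu_prod_XsubC.
have rE : rootsR p =i L.
  move=> x; have := roots_on_rootsR p0 x; rewrite in_itv /= => <-.
  by rewrite pL root_prod_XsubC.
have -> : \sum_i Num.sqrt (lam i) = \sum_(y <- L) Num.sqrt y.
  by rewrite /L codomE big_map big_enum.
rewrite -[RHS]big_undup_iterop_count /=.
rewrite [RHS](perm_big (rootsR p)); last first.
  apply: uniq_perm; [exact: undup_uniq | exact: uniq_roots |].
  by move=> x; rewrite mem_undup rE.
by [].
Qed.

(** Over R[i] the Hermitian matrix A^T A is unitarily diagonalizable; its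
    eigenvalues are squared norms of columns of A P^-1, for P the diagonalizing
    unitary matrix, so they are nonnegative and come from R. *)
Lemma singular_spectrum (R : rcfType) (m n : nat) (A : 'M[R]_(m, n)) :
  exists lam : 'I_n -> R,
  [/\ forall i, 0 <= lam i,
      trace_norm A = \sum_i Num.sqrt (lam i),
      \sum_i lam i = \tr (A^T *m A),
      \sum_i lam i ^+ 2 = \tr (A^T *m A *m (A^T *m A)) &
      (#|[set i | lam i != 0%R]| <= \rank A)%N].
Proof.
pose f : {rmorphism R -> R[i]} := real_complex R.
pose B := map_mx f (A^T *m A).
have Breal m' n' (X : 'M[R]_(m', n')) :
    map_mx Num.conj (map_mx f X) = map_mx f X.
  apply/matrixP=> i j; rewrite !mxE.
  by apply/CrealP/complex_realP; exists (X i j).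
have Bherm : B \is hermsymmx.
  apply/is_hermitianmxP; rewrite expr0 scale1r -[in RHS]map_trmx.
  by rewrite Breal map_trmx trmx_mul trmxK.
have /hermitian_normalmx/orthomx_spectralP := Bherm.
set P := spectralmx B; set d := spectral_diag B => BE.
have Pun : P \is unitarymx by exact: spectral_unitarymx.
have Pu : P \in unitmx by exact: spectral_unit.
pose Q := map_mx f A *m invmx P.
have DE : diag_mx d = (map_mx Num.conj Q)^T *m Q.
  have PE : (map_mx Num.conj (invmx P))^T = P.
    by rewrite invmx_unitary //; apply/matrixP=> i j; rewrite !mxE /= conjCK.
  rewrite /Q map_mxM Breal trmx_mul PE map_trmx !mulmxA.
  rewrite -[P *m _ *m _]mulmxA -map_mxM -/B BE.
  by rewrite -mulmxA mulmxK // mulmxA mulmxV // mul1mx.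
have d_ge0 i : 0 <= d 0 i.
  have /matrixP/(_ i i) := DE; rewrite !mxE eqxx mulr1n => ->.
  by apply: sumr_ge0 => k _; rewrite !mxE mulrC mul_conjC_ge0.
pose lam i := complex.Re (d 0 i).
have lamE i : f (lam i) = d 0 i by exact: (RRe_real (ger0_real (d_ge0 i))).
have fI : injective f by exact: complexI.
have trE (X : 'M[R]_n) : f (\tr X) = \tr (map_mx f X).
  by rewrite (trace_map_mx f).
exists lam; split.
- by move=> i; rewrite -ler0c -[_%:C%C]/(f _) lamE.
- apply: trace_norm_prodXsubC; apply: (map_poly_inj f).
  rewrite map_char_poly -/B BE char_poly_conj // char_poly_diag rmorph_prod /=.
  by apply: eq_bigr => i _; rewrite map_polyXsubC -lamE.
- apply: fI; rewrite trE -/B BE -mulmxA mxtrace_mulC mulmxK //.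
  by rewrite mxtrace_diag (rmorph_sum f); apply: eq_bigr => i _; exact: lamE.
- apply: fI; rewrite trE map_mxM -/B BE !mulmxA mulmxK //.
  rewrite -!mulmxA mxtrace_mulC -!mulmxA mulmxV // mulmx1 mulmx_diag.
  rewrite mxtrace_diag (rmorph_sum f); apply: eq_bigr => i _.
  by rewrite mxE (rmorphXn f) -lamE expr2.
- apply: leq_trans (_ : \rank (A^T *m A) <= _)%N; last exact: mxrankM_maxr.
  have -> : \rank (A^T *m A) = \rank (diag_mx d).
    rewrite -(mxrank_map f) -/B BE mxrankMfree ?row_free_unit //.
    by rewrite eqmxMfull // row_full_unit unitmx_inv.
  apply: leq_trans (rank_diag_mx_ge d); apply: subset_leq_card.
  by apply/subsetP => i; rewrite !inE -lamE fmorph_eq0.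
Qed.

(** * Off-diagonal sums and bounds on the trace norm *)

Definition offdiag_sum (R : nzRingType) n (u : 'I_n -> R) : R :=
  \sum_(p : 'I_n * 'I_n | p.1 != p.2) u p.1 * u p.2.

Lemma sqr_sum_offdiag (R : nzRingType) n (u : 'I_n -> R) :
  (\sum_i u i) ^+ 2 = \sum_i u i ^+ 2 + offdiag_sum u.
Proof.
rewrite expr2 big_distrlr /= pair_big /= (bigID (fun p => p.1 == p.2)) /=.
congr (_ + _); rewrite (reindex_onto (fun i => (i, i)) fst) /=.
  by apply: eq_big => [i|i _]; rewrite ?eqxx // expr2.
by case=> i j /= /eqP ->.
Qed.

Section OffDiagonal.
Variables (R : rcfType) (n : nat) (s : 'I_n -> R).
Hypothesis s_ge0 : forall i, 0 <= s i.

Lemma offdiag_sum_ge0 : 0 <= offdiag_sum s.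
Proof. by apply: sumr_ge0 => p _; apply: mulr_ge0. Qed.

Lemma offdiag_sum_two i j : i != j ->
  offdiag_sum s = 2 * (s i * s j) +
    \sum_(p : 'I_n * 'I_n | (p.1 != p.2) && (p != (i, j)) && (p != (j, i)))
       s p.1 * s p.2.
Proof.
move=> ij; rewrite /offdiag_sum (bigD1 (i, j)) //= (bigD1 (j, i)) /=; last first.
  by rewrite eq_sym ij xpair_eqE negb_and eq_sym ij.
by rewrite addrA [s j * _]mulrC -mulr2n mulr_natl.
Qed.

(** In the product of the off-diagonal sum with itself, each pair (i, j) meets
    both (i, j) and (j, i), which accounts for the factor 2; the remaining
    products are nonnegative. *)
Lemma sqr_offdiag_sum_ge :
  2 * offdiag_sum (fun i => s i ^+ 2) <= offdiag_sum s ^+ 2.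
Proof.
rewrite expr2 {1 2}/offdiag_sum mulr_sumr mulr_suml.
apply: ler_sum => -[i j] /= ij; rewrite (offdiag_sum_two ij).
rewrite -exprMn mulrDr [X in _ <= X + _]mulrCA -expr2 lerDl.
rewrite mulr_ge0 // ?mulr_ge0 //.
by apply: sumr_ge0 => p _; apply: mulr_ge0.
Qed.

(** With at most two nonzero terms, the products discarded in
    [sqr_offdiag_sum_ge] vanish. *)
Lemma sqr_offdiag_sum_supp2 : (#|[set i | s i != 0%R]| <= 2)%N ->
  offdiag_sum s ^+ 2 = 2 * offdiag_sum (fun i => s i ^+ 2).
Proof.
move=> supp2; rewrite expr2 {1 3}/offdiag_sum mulr_suml mulr_sumr.
apply: eq_bigr => -[i j] /= ij.
have [->|si] := eqVneq (s i) 0; first by rewrite expr0n /= !(mul0r, mulr0).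
have [->|sj] := eqVneq (s j) 0; first by rewrite expr0n /= !(mul0r, mulr0).
rewrite (offdiag_sum_two ij) big1; first by rewrite addr0 -exprMn mulrCA -expr2.
case=> k l /= /andP[/andP[kl kl_ij] kl_ji].
have suppE : [set i; j] = [set i | s i != 0].
  apply/eqP; rewrite eqEcard cards2 ij supp2 andbT.
  by apply/subsetP => x; rewrite !inE => /orP[] /eqP ->.
apply/eqP; rewrite mulf_eq0; apply/norP => -[sk sl].
have: k \in [set i; j] by rewrite suppE inE.
have: l \in [set i; j] by rewrite suppE inE.
rewrite !inE => l_ij k_ij; move: l_ij k_ij kl kl_ij kl_ji.
by case/pred2P=> -> /pred2P[] ->; rewrite !eqxx.
Qed.

End OffDiagonal.

(** Twice the second elementary symmetric function of the eigenvalues of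
    A^T A; by the Cauchy-Binet formula, twice the sum of the squares of the
    2 x 2 minors of A.  It vanishes exactly if A has rank at most 1. *)
Definition gram_defect (R : rcfType) (m n : nat) (A : 'M[R]_(m, n)) : R :=
  (\tr (A^T *m A)) ^+ 2 - \tr (A^T *m A *m (A^T *m A)).

(** P is the off-diagonal sum of the singular values. *)
Lemma trace_norm_sqr (R : rcfType) (m n : nat) (A : 'M[R]_(m, n)) :
  exists P : R,
  [/\ 0 <= P, trace_norm A = Num.sqrt (\tr (A^T *m A) + P),
      2 * gram_defect A <= P ^+ 2 &
      ((\rank A <= 2)%N -> P ^+ 2 = 2 * gram_defect A)].
Proof.
have [lam [lam0 nE trE tr2E rkA]] := singular_spectrum A.
pose s i := Num.sqrt (lam i).
have s0 i : 0 <= s i by exact: sqrtr_ge0.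
have s2 i : s i ^+ 2 = lam i by rewrite sqr_sqrtr.
have WE : gram_defect A = offdiag_sum (fun i => s i ^+ 2).
  have -> : gram_defect A = (\sum_i s i ^+ 2) ^+ 2 - \sum_i (s i ^+ 2) ^+ 2.
    rewrite /gram_defect -trE -tr2E.
    by congr (_ ^+ 2 - _); apply: eq_bigr => i _; rewrite s2.
  by rewrite (sqr_sum_offdiag (fun i => s i ^+ 2)) addrC addKr.
exists (offdiag_sum s); split.
- exact: offdiag_sum_ge0.
- rewrite -trE nE -(eq_bigr lam (fun i _ => s2 i)) -sqr_sum_offdiag.
  by rewrite sqrtr_sqr ger0_norm // sumr_ge0.
- by rewrite WE sqr_offdiag_sum_ge.
- move=> rk2; rewrite WE sqr_offdiag_sum_supp2 //.
  apply: leq_trans rk2; apply: leq_trans rkA; apply: subset_leq_card.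
  apply/subsetP=> i; rewrite !inE sqrtr_eq0 -ltNge lt_neqAle eq_sym.
  by case/andP.
Qed.

Lemma trace_norm_ge (R : rcfType) (m n : nat) (A : 'M[R]_(m, n)) :
  Num.sqrt (\tr (A^T *m A) + Num.sqrt (2 * gram_defect A)) <= trace_norm A.
Proof.
have [P [P0 -> WP _]] := trace_norm_sqr A.
apply: ler_wsqrtr; rewrite lerD2l -[P in _ <= P]ger0_norm // -sqrtr_sqr.
exact: ler_wsqrtr.
Qed.

Lemma trace_norm_rank2 (R : rcfType) (m n : nat) (A : 'M[R]_(m, n)) :
  (\rank A <= 2)%N ->
  trace_norm A = Num.sqrt (\tr (A^T *m A) + Num.sqrt (2 * gram_defect A)).
Proof.
have [P [P0 -> _ WP]] := trace_norm_sqr A.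
by move=> /WP <-; rewrite sqrtr_sqr ger0_norm.
Qed.

(** * (0,1)-matrices as families of sets *)

Definition colset (m n : nat) (A : 'M[bool]_(m, n)) j : {set 'I_m} :=
  [set i | A i j].

(** The Gram determinant of the indicator vectors of X and Y. *)
Definition set_defect (T : finType) (X Y : {set T}) : nat :=
  (#|X| * #|Y| - #|X :&: Y| ^ 2)%N.

Section ZeroOne.
Variables (R : rcfType) (m n : nat) (A : 'M[bool]_(m, n)).

Lemma gram_mx01 j l :
  ((mx01 R A)^T *m mx01 R A) j l = #|colset A j :&: colset A l|%:R.
Proof.
rewrite !mxE -sum1_card natr_sum [RHS]big_mkcond /=.
by apply: eq_bigr => i _; rewrite !mxE !inE; do 2!case: (A _ _) => //=;
  rewrite ?mulr1 ?mulr0.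
Qed.

Lemma trace_mx01 :
  \tr ((mx01 R A)^T *m mx01 R A) = (\sum_j #|colset A j|)%N%:R.
Proof.
by rewrite natr_sum; apply: eq_bigr => j _; rewrite gram_mx01 setIid.
Qed.

Lemma gram_defect_mx01 :
  gram_defect (mx01 R A) =
  (\sum_j \sum_l set_defect (colset A j) (colset A l))%N%:R.
Proof.
rewrite /gram_defect trace_mx01 natr_sum expr2 big_distrlr /= /mxtrace -sumrB.
rewrite natr_sum; apply: eq_bigr => j _; rewrite [X in _ - X]mxE -sumrB natr_sum.
apply: eq_bigr => l _; rewrite !gram_mx01 [colset A l :&: _]setIC natrB.
  by rewrite natrM natrX expr2.
by rewrite -mulnn leq_mul // subset_leq_card // ?subsetIl ?subsetIr.
Qed.

End ZeroOne.

Lemma mem_Zmx n m (A : 'M[bool]_n) :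
  (A \in Zmx n m) = ((\sum_j #|colset A j|)%N == m).
Proof.
rewrite inE -sum1_card (eq_bigl (fun p : 'I_n * 'I_n => A p.1 p.2)); last first.
  by move=> p; rewrite inE.
rewrite big_mkcond.
rewrite -(pair_big xpredT xpredT (fun i j => if A i j then 1 else 0)%N) /=.
rewrite exchange_big /=; congr (_ == _); apply: eq_bigr => j _.
by rewrite -big_mkcond sum1dep_card.
Qed.

(** * The lower bound *)

Lemma set_defectC (T : finType) (X Y : {set T}) :
  set_defect X Y = set_defect Y X.
Proof. by rewrite /set_defect mulnC setIC. Qed.

(** With x, y and c the sizes of X, Y and X :&: Y: either c = y < x and the
    defect is y (x - y), or c < y and it is at least x y - (y - 1)^2. *)
Lemma set_defect_ge (T : finType) (X Y : {set T}) :
  Y != set0 -> Y != X -> (#|Y| <= #|X|)%N -> (#|X|.-1 <= set_defect X Y)%N.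
Proof.
rewrite -card_gt0 /set_defect => Y0 YX leYX.
have [sYX|nsYX] := boolP (Y \subset X).
  have: Y \proper X by rewrite properEneq YX.
  move/proper_card; rewrite (setIidPr sYX); nia.
have: (#|X :&: Y| < #|Y|)%N.
  apply: proper_card; rewrite properEneq subsetIr andbT.
  by apply: contra nsYX => /eqP <-; rewrite subsetIl.
nia.
Qed.

Section LargestColumn.
Variables (m n : nat) (A : 'M[bool]_(m, n)) (i0 : 'I_n).

Definition twins := [set j | colset A j == colset A i0].

Definition nonempty_others :=
  [set j | (colset A j != set0) && (colset A j != colset A i0)].

Lemma disjoint_twins_others : [disjoint twins & nonempty_others].
Proof.
rewrite -setI_eq0; apply/eqP/setP=> j; rewrite !inE.
by case: eqP; rewrite ?andbF.
Qed.

(** Only the pairs formed by a copy of a largest column and a different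
    nonempty column are kept, in both orders. *)
Lemma sum_set_defect_ge :
  (forall j, #|colset A j| <= #|colset A i0|)%N ->
  (2 * (#|twins| * #|nonempty_others|) * #|colset A i0|.-1
   <= \sum_j \sum_l set_defect (colset A j) (colset A l))%N.
Proof.
move=> max_i0; set T := twins; set S := nonempty_others.
pose d j l := set_defect (colset A j) (colset A l).
have TS : (#|T| * #|S| * #|colset A i0|.-1
           <= \sum_(j in T) \sum_(l in S) d j l)%N.
  rewrite -mulnA -sum_nat_const; apply: leq_sum => j; rewrite inE => /eqP jT.
  rewrite -sum_nat_const; apply: leq_sum => l; rewrite inE => /andP[l0 li].
  by rewrite /d jT set_defect_ge.
have ST : (\sum_(j in T) \sum_(l in S) d j l =
           \sum_(j in S) \sum_(l in T) d j l)%N.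
  rewrite exchange_big; apply: eq_bigr => j _; apply: eq_bigr => l _.
  exact: set_defectC.
have sub (X Y : {set 'I_n}) :
    (\sum_(j in X) \sum_(l in Y) d j l <= \sum_(j in X) \sum_l d j l)%N.
  by apply: leq_sum => j _; rewrite [leqRHS](bigID (mem Y)) leq_addr.
apply: (@leq_trans (\sum_(j in T) \sum_l d j l + \sum_(j in S) \sum_l d j l)).
  apply: leq_trans (leq_add (sub T S) (sub S T)).
  by rewrite -ST addnn -mul2n -mulnA leq_mul2l TS.
rewrite big_mkcond [X in (_ + X)%N]big_mkcond -big_split leq_sum // => j _ /=.
have := disjointFr disjoint_twins_others (x := j).
by case: (j \in T) => [-> //|_]; rewrite ?addn0 //; case: (j \in S).
Qed.

End LargestColumn.

(** Without rounding, 3 * k <= p * r - 1 gives the claim if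
    (p - 3) (r - 3) >= 4.  If p or r is 3, or if p and r are among a few small
    pairs, it follows because k is an integer, except in the excluded case. *)
Lemma cell_count_bound p r k :
  (3 <= p)%N -> (3 <= r)%N -> (3 * k < p * r)%N ->
  ~ (p = 4 /\ r = 4 /\ k = 5)%N -> (2 * k <= p.-1 * r.-1)%N.
Proof.
case: p => // p; case: r => // r /= p2 r2 k_lt exc.
have [p3|p3] := eqVneq p 2%N; first by subst p; lia.
have [r3|r3] := eqVneq r 2%N; first by subst r; lia.
have [pr|pr] := leqP 4 ((p - 2) * (r - 2)); first by nia.
have: (p <= 5)%N by nia.
have: (r <= 5)%N by nia.
move: p r p2 r2 k_lt exc p3 r3 pr.
by move=> [|[|[|[|[|[|p]]]]]] // [|[|[|[|[|[|r]]]]]] //; lia.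
Qed.

Lemma sum_set_defect_lower n m (A : 'M[bool]_n) :
  (2 * n < m <= 3 * n)%N -> A \in Zmx n m ->
  (forall a b, a <= n -> b <= n -> a * b <> m)%N ->
  (4 * (m %/ 3) <= \sum_j \sum_l set_defect (colset A j) (colset A l))%N.
Proof.
move=> /andP[m_gt m_le]; rewrite mem_Zmx => /eqP mE norect.
have n_gt0 : (0 < n)%N by lia.
have [i0 _ max_i0] :=
  arg_maxnP (fun j => #|colset A j|) (erefl : xpredT (Ordinal n_gt0)).
apply: leq_trans (sum_set_defect_ge (i0 := i0) _); last first.
  by move=> j; exact: max_i0.
set T := twins A i0; set S := nonempty_others A i0; set r := #|colset A i0|.
have rn : (r <= n)%N by rewrite -[leqRHS]card_ord max_card.
have pn : (#|T| + #|S| <= n)%N.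
  have := (leq_card_setU T S).2; rewrite disjoint_twins_others => /eqP <-.
  by rewrite -[leqRHS]card_ord max_card.
have mTS : m = (#|T| * r + \sum_(j in S) #|colset A j|)%N.
  rewrite -mE (bigID (mem T)) /=; congr (_ + _)%N.
    rewrite -sum_nat_const; apply: eq_bigr => j.
    by rewrite inE => /eqP ->.
  rewrite [LHS]big_mkcond [RHS]big_mkcond; apply: eq_bigr => j _; rewrite !inE.
  by case: (colset A j =P set0) => [->|_] /=; rewrite ?cards0 ?if_same.
have Sr : (\sum_(j in S) #|colset A j| <= #|S| * r)%N.
  by rewrite -sum_nat_const; apply: leq_sum => j _; exact: max_i0.
have T1 : (0 < #|T|)%N by apply/card_gt0P; exists i0; rewrite inE.
have m_le_pr : (m <= (#|T| + #|S|) * r)%N by rewrite mulnDl mTS leq_add2l.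
have m_lt : (m < (#|T| + #|S|) * r)%N.
  by rewrite ltn_neqAle m_le_pr andbT; apply/eqP => /esym; exact: norect.
have S1 : (0 < #|S|)%N.
  rewrite lt0n; apply/eqP => S0; move: Sr mTS m_lt; rewrite S0 !addn0 mul0n.
  by rewrite leqn0 => /eqP -> ->; rewrite addn0 ltnn.
set t := #|T| in pn m_le_pr m_lt T1 *; set s := #|S| in pn m_le_pr m_lt S1 *.
have k_le : (2 * (m %/ 3) <= (t + s).-1 * r.-1)%N.
  apply: cell_count_bound; [nia | nia | lia |].
  (* Here m = 15: it is at most 15 as m < 16, and at least 15 as m %/ 3 = 5. *)
  by move=> [p4 [r4 k5]]; apply: (norect 3 5)%N; lia.
have ts_ge : ((t + s).-1 <= t * s)%N by move: T1 S1; clear; nia.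
rewrite -mulnA -[4%N]/(2 * 2)%N -mulnA leq_mul2l /=.
by apply: leq_trans k_le _; rewrite leq_mul2r ts_ge orbT.
Qed.

(** * Matrices attaining the minimum *)

Section EuclidWitness.
Variables (n a m : nat).
Hypotheses (a_gt0 : (0 < a)%N) (a_le : (a <= n)%N) (m_le : (m <= a * n)%N).

(** The first a rows are filled with m ones column by column, so that the
    Euclidean division of m by a gives the numbers of full columns and of
    remaining ones. *)
Definition euclid_mx : 'M[bool]_n :=
  \matrix_(i, j) ((i < a) && (a * j + i < m))%N.

Let k := (m %/ a)%N.
Let t := (m %% a)%N.
Let w (j : nat) := (if j < k then a else if j == k then t else 0)%N.

Lemma euclid_mxE i j : euclid_mx i j = (i < w j)%N.
Proof.
rewrite mxE /w; have := divn_eq m a; rewrite -/k -/t => mE.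
have ta : (t < a)%N by rewrite ltn_mod.
case: (ltnP i a) => ia /=; last first.
  by case: (ltngtP j k) => _; apply/esym/negbTE; rewrite -leqNgt // (leq_trans (ltnW ta)).
case: (ltngtP j k) => jk; rewrite ?ia.
- have : (a * j.+1 <= a * k)%N by rewrite leq_mul2l jk orbT.
  by rewrite mulnS [(a * k)%N]mulnC; lia.
- have : (a * k.+1 <= a * j)%N by rewrite leq_mul2l jk orbT.
  by rewrite mulnS [(a * k)%N]mulnC; lia.
- by rewrite jk mE mulnC ltn_add2l.
Qed.

Lemma euclid_height_le (j : nat) : (w j <= n)%N.
Proof.
rewrite /w; case: (ltngtP j k) => // _.
by rewrite (leq_trans _ a_le) // ltnW // ltn_mod.
Qed.

Lemma euclid_heightE j : (w j = a * (j < k) + t * (j == k))%N.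
Proof. by rewrite /w; case: (ltngtP j k); rewrite ?(muln0, muln1, addn0). Qed.

Lemma euclid_quo_le : (k <= n)%N.
Proof. by rewrite -(mulKn n a_gt0) leq_div2r. Qed.

(** If all n columns are full, then nothing remains for an incomplete one. *)
Lemma euclid_rem0_or_quo_lt : (t = 0 \/ k < n)%N.
Proof.
have := divn_eq m a; rewrite -/k -/t; have := euclid_quo_le.
by case: (ltngtP k n); nia.
Qed.

Lemma card_ord_lt x : (x <= n)%N -> #|[set i : 'I_n | i < x]%N| = x.
Proof.
move=> xn; rewrite cardsE -sum1_card.
by rewrite (big_ord_narrow xn) sum_nat_const card_ord muln1.
Qed.

Lemma sum_ord_lt x : (x <= n)%N -> (\sum_(j < n) (j < x) = x)%N.
Proof. by move=> xn; rewrite -big_mkcond sum1dep_card card_ord_lt. Qed.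

Lemma sum_ord_eq x : (\sum_(j < n) (j == x :> nat) = (x < n))%N.
Proof.
have [xn|nx] := ltnP x n; last first.
  by rewrite big1 // => j _; rewrite ltn_eqF // (leq_trans (ltn_ord j)).
rewrite (bigD1 (Ordinal xn)) //= eqxx big1 // => j.
by rewrite -val_eqE /= => /negbTE ->.
Qed.

Lemma card_colset_euclid (j l : 'I_n) :
  #|colset euclid_mx j :&: colset euclid_mx l| = minn (w j) (w l).
Proof.
rewrite -(@card_ord_lt (minn (w j) (w l))); last first.
  by rewrite geq_min euclid_height_le.
by apply: eq_card => i; rewrite !inE !euclid_mxE leq_min.
Qed.

Lemma euclid_mx_Zmx : euclid_mx \in Zmx n m.
Proof.
rewrite mem_Zmx; apply/eqP.
under eq_bigr => j _
  do rewrite -[colset _ _]setIid card_colset_euclid minnn euclid_heightE.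
rewrite big_split -!big_distrr /= sum_ord_lt ?euclid_quo_le // sum_ord_eq mulnC.
rewrite [RHS](divn_eq m a) -/k -/t; congr (_ + _)%N.
by case: euclid_rem0_or_quo_lt => ->; rewrite ?muln1.
Qed.

(** The columns are nested, so two of them of heights x <= y contribute
    x (y - x), which is nonzero only for a full and the incomplete column. *)
Lemma sum_set_defect_euclid :
  (\sum_j \sum_l set_defect (colset euclid_mx j) (colset euclid_mx l)
   = 2 * (k * (t * (a - t))))%N.
Proof.
have dE (j l : 'I_n) : set_defect (colset euclid_mx j) (colset euclid_mx l) =
    (t * (a - t) * ((j < k) * (l == k :> nat))
     + t * (a - t) * ((j == k :> nat) * (l < k)))%N.
  rewrite /set_defect -[in X in (X * _)%N](setIid (colset _ j)).
  rewrite -[in X in (_ * X - _)%N](setIid (colset _ l)).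
  rewrite !card_colset_euclid !minnn.
  have ta : (t < a)%N by rewrite ltn_mod.
  rewrite /w; case: (ltngtP j k) => _; case: (ltngtP l k) => _ /=;
  rewrite ?minnn ?min0n ?minn0 ?(minn_idPr (ltnW ta)) ?(minn_idPl (ltnW ta));
  nia.
have rowE (j : 'I_n) :
    (\sum_l set_defect (colset euclid_mx j) (colset euclid_mx l) =
     t * (a - t) * (k < n) * (j < k) + t * (a - t) * k * (j == k :> nat))%N.
  rewrite (eq_bigr _ (fun l _ => dE j l)) big_split -!big_distrr /=.
  by rewrite sum_ord_eq sum_ord_lt ?euclid_quo_le //; lia.
rewrite (eq_bigr _ (fun j _ => rowE j)) big_split -!big_distrr /=.
rewrite sum_ord_eq sum_ord_lt ?euclid_quo_le //.
by case: euclid_rem0_or_quo_lt => ->; rewrite ?mul0n ?muln0 //; lia.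
Qed.

Lemma rank_euclid_mx (R : rcfType) : (\rank (mx01 R euclid_mx) <= 2)%N.
Proof.
(* The block of full columns and the incomplete column have rank at most one each. *)
pose U : 'M[R]_(n, 2) :=
  \matrix_(i, b) (i < (if b == 0 :> nat then a else t))%N%:R.
pose V : 'M[R]_(2, n) :=
  \matrix_(b, j) (if b == 0 :> nat then j < k else j == k :> nat)%N%:R.
have -> : mx01 R euclid_mx = U *m V.
  apply/matrixP => i j; rewrite [LHS]mxE euclid_mxE [RHS]mxE.
  rewrite big_ord_recl big_ord1 !mxE /= /w.
  by case: (ltngtP j k) => _; rewrite ?(mulr0, mulr1, addr0, add0r).
exact: mulmx_max_rank.
Qed.

Lemma trace_norm_euclid_mx (R : rcfType) :
  trace_norm (mx01 R euclid_mx) =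
  Num.sqrt (m%:R + 2 * Num.sqrt (k * (t * (a - t)))%:R).
Proof.
rewrite (trace_norm_rank2 (rank_euclid_mx R)) trace_mx01 gram_defect_mx01.
have := euclid_mx_Zmx; rewrite mem_Zmx => /eqP ->.
rewrite sum_set_defect_euclid -natrM mulnA natrM sqrtrM ?ler0n //.
by rewrite (_ : (2 * 2)%N%:R = 2 ^+ 2) ?sqrtr_sqr ?ger0_norm ?ler0n // -natrX.
Qed.

End EuclidWitness.

(** * Factorizations with both factors at most n *)

Lemma no_rectangle_prime_factor n m q :
  prime q -> (q %| m)%N -> (n < q)%N -> (0 < m)%N ->
  forall a b, (a <= n -> b <= n -> a * b <> m)%N.
Proof.
move=> pq qm nq m0 a b an bn abm; move: qm m0.
rewrite -abm Euclid_dvdM // muln_gt0.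
by case/orP=> /dvdn_leq qle /andP[a0 b0];
  [have := qle a0 | have := qle b0]; lia.
Qed.

(** As m <= 3 n, it suffices to write m as a product of two factors that are
    at least 3. *)
Lemma rectangle_exists n m : (4 <= n)%N -> (2 * n < m <= 3 * n)%N ->
  ~ (prime m \/ exists2 p : nat, prime p & m = (2 * p)%N) ->
  exists a b, [/\ (0 < a)%N, (a <= n)%N, (b <= n)%N & (a * b = m)%N].
Proof.
move=> hn /andP[m_gt m_le] hm.
have split_least x : (1 < x)%N -> ~~ prime x ->
    exists q d, [/\ (1 < q)%N, (q <= d)%N & (q * d = x)%N].
  move=> x1 xp; have xE := divnK (pdiv_dvd x).
  have q1 := prime_gt1 (pdiv_prime x1).
  exists (pdiv x), (x %/ pdiv x)%N; split; [by []| |by rewrite mulnC].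
  rewrite -(leq_pmul2l (ltnW q1)) [leqRHS]mulnC xE leqNgt.
  apply: contra xp => lt_x; apply: ltn_pdiv2_prime; lia.
suff [a [b [a3 b3 abE]]] : exists a b, [/\ (3 <= a)%N, (3 <= b)%N & (a * b = m)%N].
  by exists a, b; split; nia.
have mp : ~~ prime m by apply/negP => mp; apply: hm; left.
have [|q [d [q1 qd qdE]]] := split_least m _ mp; first by lia.
have [q3|q3] := leqP 3 q; first by exists q, d; split; lia.
have q2 : q = 2%N by lia.
have dp : ~~ prime d.
  by apply/negP => dp; apply: hm; right; exists d; rewrite // -qdE q2.
have [|q' [d' [q'1 q'd' qdE']]] := split_least d _ dp; first by nia.
(* m = (2 * q') * d', and d' = 2 would force m = 8, contrary to m > 2 * 4. *)
by exists (2 * q')%N, d'; split; nia.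
Qed.

(** * The minimum *)

Lemma psi_eq (R : rcfType) n m (A : 'M[bool]_n) :
  A \in Zmx n m ->
  (forall B, B \in Zmx n m ->
     trace_norm (mx01 R A) <= trace_norm (mx01 R B)) ->
  psi R n m = trace_norm (mx01 R A).
Proof.
move=> AZ minA; rewrite /psi; case: pickP => [A0 A0Z|/(_ A)]; last by rewrite AZ.
case: Order.TotalTheory.arg_minP => // B BZ minB.
by apply/le_anti; rewrite minB ?minA.
Qed.

Theorem theorem3 (R : rcfType) (n m : nat)
    (hn : (4 <= n)%N) (hm : (2 * n < m <= 3 * n)%N) :
  ((prime m \/ exists2 p : nat, prime p & m = (2 * p)%N) ->
     psi R n m = Num.sqrt (m%:R + 2 * Num.sqrt (2 * (m %/ 3)%N%:R)))
  /\
  (~ (prime m \/ exists2 p : nat, prime p & m = (2 * p)%N) ->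
     psi R n m = Num.sqrt m%:R).
Proof.
have /andP[m_gt m_le] := hm.
have normB_ge (B : 'M[bool]_n) : B \in Zmx n m ->
    Num.sqrt (m%:R + Num.sqrt (2 * gram_defect (mx01 R B)))
    <= trace_norm (mx01 R B).
  rewrite mem_Zmx => /eqP mE; apply: le_trans (trace_norm_ge _).
  by rewrite trace_mx01 mE.
split=> [hp|/(rectangle_exists hn hm)[a [b [a0 an bn abm]]]].
- have norect a b : (a <= n -> b <= n -> a * b <> m)%N.
    have m0 : (0 < m)%N by lia.
    case: hp => [pm|[p pp mp]].
      by apply: (no_rectangle_prime_factor pm); rewrite ?dvdnn //; lia.
    by apply: (no_rectangle_prime_factor pp); rewrite ?mp ?dvdn_mull //; lia.
  have n3 : (3 <= n)%N by lia.
  have r0 : (m %% 3 != 0)%N.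
    apply/eqP => m3; apply: (norect 3 (m %/ 3))%N; lia.
  have rE : ((m %% 3) * (3 - m %% 3) = 2)%N.
    by have := ltn_pmod m (isT : 0 < 3)%N; move: (m %% 3)%N r0 => [|[|[|]]].
  have nE := trace_norm_euclid_mx (isT : 0 < 3)%N n3 m_le R.
  rewrite rE mulnC natrM in nE.
  rewrite -nE; apply: psi_eq; first exact: euclid_mx_Zmx.
  move=> B BZ; rewrite nE; apply: le_trans (normB_ge B BZ).
  apply: ler_wsqrtr; rewrite lerD2l gram_defect_mx01.
  have -> (x : R) : 2 * Num.sqrt x = Num.sqrt (4 * x).
    rewrite sqrtrM ?ler0n // (_ : 4 = 2 ^+ 2) -?natrX //.
    by rewrite natrX sqrtr_sqr ger0_norm // ler0n.
  apply: ler_wsqrtr; rewrite -!natrM ler_nat.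
  by have := sum_set_defect_lower hm BZ norect; lia.
- have m_le_a : (m <= a * n)%N by rewrite -abm leq_mul2l bn orbT.
  have nE := trace_norm_euclid_mx a0 an m_le_a R.
  rewrite [X in (X * (a - X))%N](_ : _ = 0)%N in nE; last first.
    by rewrite -abm modnMr.
  rewrite mul0n muln0 sqrtr0 mulr0 addr0 in nE.
  rewrite -nE; apply: psi_eq; first exact: euclid_mx_Zmx.
  move=> B BZ; rewrite nE; apply: le_trans (normB_ge B BZ).
  by apply: ler_wsqrtr; rewrite lerDl sqrtr_ge0.
Qed.
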